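(* Let $R$ be an integral domain that is not a field. Then every open set of $\widetilde{M(R)}$, except for $\sigma_0=U(R)$, is open in $\widetilde{G(R)}$.
   Context: For $r\in R$ let $\sigma_r:=\{s\in R: \langle r\rangle+\langle s\rangle=R\}$, where $\langle r\rangle$ is the ideal generated by $r$; in particular $\sigma_0=U(R)$, the set of units of $R$. $\widetilde{M(R)}$ is the set $R$ with the topology having basis $\{\sigma_r: r\in R\}$. $\widetilde{G(R)}$ is the set $R$ with the topology generated by the collection of coprime cosets, i.e. cosets $x+I$ with $x\in R$, $I$ a nonzero ideal of $R$, and $\langle x\rangle+I=R$. *)

(* Defs.v *)
From HB Require Import structures.
From mathcomp Require Import all_boot all_algebra.
From mathcomp Require Import all_classical topology.

Set Implicit Arguments.
Unset Strict Implicit.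
Unset Printing Implicit Defensive.

Import GRing.Theory.

Local Open Scope classical_set_scope.
Local Open Scope ring_scope.

Section Ideals.
Variable R : comNzRingType.
Implicit Types (I J : set R) (r s x : R).

(* The unit and zero ideals are allowed, whereas [idealr] of ring_quotient is
   restricted to proper ideals with a boolean membership predicate. *)
Definition is_ideal I : Prop :=
  [/\ I 0,
      forall a b, I a -> I b -> I (a + b)
    & forall a b, I b -> I (a * b)].

Definition ideal_gen r : set R := smallest is_ideal [set r].

Definition ideal_add I J : set R :=
  [set z | exists a b, [/\ I a, J b & z = a + b]].

Definition sigma r : set R :=
  [set s | ideal_add (ideal_gen r) (ideal_gen s) = setT].

Definition coset x I : set R := [set x + i | i in I].

Definition coprime_coset : set (set R) :=
  [set C | exists x I, [/\ is_ideal I, I <> [set 0],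
                           ideal_add (ideal_gen x) I = setT & C = coset x I]].

Lemma ideal_genE r : ideal_gen r = [set z | exists a, z = a * r].
Proof.
apply/seteqP; split => [|z [a ->]].
  apply: smallest_sub => [|_ ->]; last by exists 1; rewrite mul1r.
  split; first by exists 0; rewrite mul0r.
    by move=> _ _ [a ->] [b ->]; exists (a + b); rewrite mulrDl.
  by move=> a _ [b ->]; exists (a * b); rewrite mulrA.
by move=> J [[_ _ JM] rJ]; apply: JM; apply: rJ.
Qed.

Lemma sigmaP r s : sigma r s <-> exists a b, a * r + b * s = 1.
Proof.
rewrite /sigma /= !ideal_genE; split => [rsT|[a [b ab1]]].
  have : [set: R] 1 by [].
  rewrite -rsT => -[_ [_ [[a ->] [b ->] e]]].
  by exists a, b.
apply/seteqP; split => // z _.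
exists (z * a * r), (z * b * s); split; first by exists (z * a).
  by exists (z * b).
by rewrite -!mulrA -mulrDr ab1 mulr1.
Qed.

Lemma sigma1 : sigma 1 = setT.
Proof.
apply/seteqP; split => // s _; apply/sigmaP.
by exists 1, 0; rewrite mul0r mulr1 addr0.
Qed.

Lemma sigmaM r s : sigma (r * s) = sigma r `&` sigma s.
Proof.
apply/seteqP; split => t.
  move=> /sigmaP[a [b ab1]]; split; apply/sigmaP.
    by exists (a * s), b; rewrite -mulrA (mulrC s).
  by exists (a * r), b; rewrite -mulrA.
move=> [/sigmaP[a [b ab1]] /sigmaP[c [d cd1]]]; apply/sigmaP.
exists (a * c), (a * r * d + b); rewrite -[RHS]ab1 -[in RHS](mulr1 (a * r)).
rewrite -[in RHS]cd1 mulrDl mulrDr addrA; congr (_ + _ + _).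
  by rewrite mulrACA.
by rewrite mulrA.
Qed.

End Ideals.

Lemma sigma0 (R : comUnitRingType) :
  @sigma R 0 = [set u | u \is a GRing.unit].
Proof.
apply/seteqP; split => u.
  move=> /sigmaP[a [b]]; rewrite mulr0 add0r => bu1.
  by apply/unitrPr; exists b; rewrite mulrC.
move=> /= uU; apply/sigmaP; exists 0, u^-1.
by rewrite mulr0 add0r mulVr.
Qed.

(* Mtilde R and Gtilde R are copies of the carrier R, so that each of them can
   bear its own topology. *)
Definition Mtilde (R : comNzRingType) : Type := R.
Definition Gtilde (R : comNzRingType) : Type := R.

Section Mtilde.
Variable R : comNzRingType.

HB.instance Definition _ := Choice.copy (Mtilde R) R.

Let Mtilde_cover :
  \bigcup_(A in range (@sigma R)) (A : set (Mtilde R)) = setT.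
Proof.
apply/seteqP; split => // t _; exists (@sigma R 1); first by exists 1.
by rewrite sigma1.
Qed.

Let Mtilde_join (A B : set (Mtilde R)) (t : Mtilde R) :
  range (@sigma R) A -> range (@sigma R) B -> A t -> B t ->
  exists C : set (Mtilde R), [/\ range (@sigma R) C, C t & C `<=` A `&` B].
Proof.
move=> [r _ <-] [s _ <-] rt st; exists (sigma (r * s)).
by split; [exists (r * s)|rewrite sigmaM|rewrite sigmaM].
Qed.

HB.instance Definition _ := @isBaseTopological.Build (Mtilde R)
  (set R) (range (@sigma R)) id Mtilde_cover Mtilde_join.

End Mtilde.

Section Gtilde.
Variable R : comNzRingType.

HB.instance Definition _ := Choice.copy (Gtilde R) R.

HB.instance Definition _ := @isSubBaseTopological.Build (Gtilde R)
  (set R) (@coprime_coset R) id.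

End Gtilde.

Lemma Mtilde_openE (R : comNzRingType) (U : set R) :
  @open (Mtilde R) U <->
  exists2 F : set (set R), F `<=` range (@sigma R) & U = \bigcup_(A in F) A.
Proof. by split=> [[F sF <-]|[F sF ->]]; exists F. Qed.

Lemma Gtilde_openE (R : comNzRingType) (U : set R) :
  @open (Gtilde R) U <->
  exists2 F : set (set R), F `<=` finI_from (@coprime_coset R) id
                         & U = \bigcup_(A in F) A.
Proof. by split=> [[F sF <-]|[F sF ->]]; exists F. Qed.

(* Main.v *)
(** If r <> 0, then sigma_r is a union of coprime cosets x + <r>, because
    coprimality to r only depends on the class modulo r. A basic open set
    sigma_0 can be dropped from any union with another sigma_r, since units
    lie in every sigma_r. *)
Require Import Defs.
From mathcomp Require Import all_boot all_algebra.
From mathcomp Require Import all_classical topology.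

Import GRing.Theory.

Local Open Scope classical_set_scope.
Local Open Scope ring_scope.

Lemma is_ideal_ideal_gen (R : comNzRingType) (r : R) : is_ideal (ideal_gen r).
Proof.
rewrite ideal_genE; split; first by exists 0; rewrite mul0r.
  by move=> _ _ [a ->] [b ->]; exists (a + b); rewrite mulrDl.
by move=> a _ [b ->]; exists (a * b); rewrite mulrA.
Qed.

Lemma ideal_gen_neq0 (R : comNzRingType) (r : R) :
  r != 0 -> ideal_gen r <> [set 0].
Proof.
move=> /eqP r0 rI; apply: r0.
suff : ideal_gen r r by rewrite rI.
by rewrite ideal_genE; exists 1; rewrite mul1r.
Qed.

(** [sigma r] puts the ideal of r first, while [coprime_coset] puts that of the representative
    first. *)
Lemma sigma_sym (R : comNzRingType) (r s : R) : sigma r s -> sigma s r.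
Proof. by move=> /sigmaP[a [b ab1]]; apply/sigmaP; exists b, a; rewrite addrC. Qed.

Lemma sigma0_sub (R : comNzRingType) (r : R) : sigma (0 : R) `<=` sigma r.
Proof.
move=> u /sigmaP[a [b ab1]]; apply/sigmaP.
(* Since a * 0 vanishes, [ab1] says b * u = 1, so r can take the coefficient 0. *)
by exists 0, b; rewrite mul0r -(mulr0 a).
Qed.

Lemma coset_sub_sigma (R : comNzRingType) (r x : R) :
  sigma r x -> coset x (ideal_gen r) `<=` sigma r.
Proof.
move=> /sigmaP[a [b ab1]] _ [i + <-]; rewrite ideal_genE => -[c ->].
(* Replacing x by x + c * r adds b * c * r to the Bezout relation; the coefficient of r compensates
   for it. *)
apply/sigmaP; exists (a - b * c), b.
by rewrite -ab1 mulrBl mulrDr mulrA (addrC (b * x)) addrA subrK.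
Qed.

Lemma coset_refl (R : comNzRingType) (x r : R) : coset x (ideal_gen r) x.
Proof.
by exists 0; [have [] := is_ideal_ideal_gen _ r|rewrite addr0].
Qed.

Lemma coprime_coset_open (R : comNzRingType) (C : set R) :
  coprime_coset C -> @open (Gtilde R) C.
Proof.
move=> CC; apply/Gtilde_openE; exists [set C]; last by rewrite bigcup_set1.
by move=> _ ->; exact: (@finI_from1 _ _ (@coprime_coset R) id C).
Qed.

Lemma sigma_open (R : comNzRingType) (r : R) :
  r != 0 -> @open (Gtilde R) (sigma r).
Proof.
move=> r0.
have -> : sigma r = \bigcup_(x in sigma r) coset x (ideal_gen r).
  apply/seteqP; split=> [x rx|x [y ry]]; last exact: coset_sub_sigma.
  by exists x => //; exact: coset_refl.
apply: (@bigcup_open (Gtilde R)) => x rx; apply: coprime_coset_open.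
exists x, (ideal_gen r); split => //; first exact: is_ideal_ideal_gen.
  (* Here r != 0 enters: coprime cosets are taken modulo nonzero ideals. *)
  exact: ideal_gen_neq0.
exact: sigma_sym rx.
Qed.

Theorem theorem2p8 (R : idomainType) (hR : ~ GRing.field_axiom R)
    (U : set R) :
  @open (Mtilde R) U -> U <> sigma (0 : R) -> @open (Gtilde R) U.
Proof.
move=> /Mtilde_openE[F Fsigma ->] U0.
have [[r [r0 Fr]]|nF] := pselect (exists r : R, r != 0 /\ F (sigma r)).
  have -> : \bigcup_(A in F) A =
      \bigcup_(s in [set s : R | s != 0 /\ F (sigma s)]) sigma s.
    apply/seteqP; split => x; last by move=> [s [_ Fs] sx]; exists (sigma s).
    move=> [A FA]; have [s _ sA] := Fsigma _ FA.
    rewrite -sA in FA *; have [s0|s0] := eqVneq s 0; last by exists s.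
    (* A member with index 0 is absorbed by [sigma r], which the reindexed union retains. *)
    by rewrite s0 => x0; exists r => //; exact: sigma0_sub x0.
  by apply: (@bigcup_open (Gtilde R)) => s [s0 _]; exact: sigma_open.
(* With no nonzero index available, F has at most the member [sigma 0]; its union is then empty,
   hence open, or [sigma 0], which [U0] excludes. *)
have F0 A : F A -> A = sigma (0 : R).
  move=> FA; have [s _ sA] := Fsigma _ FA.
  have [<-//|s0] := eqVneq s 0; case: nF; exists s; split => //.
  by rewrite sA.
have [FE|/set0P[A FA]] := eqVneq F set0.
  by rewrite FE bigcup_set0; exact: (@open0 (Gtilde R)).
case: U0; apply/seteqP; split=> [x [B /F0 ->]//|x x0].
by exists A => //; rewrite (F0 _ FA).
Qed.
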